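(* Let $G$ be a locally compact, compactly generated group and let $\mu$ be a cohomologically adapted probability measure on $G$. Let $\pi : G \to \mathcal{O}(E)$ be a continuous isometric representation of $G$ on a Banach space $E$ and let $b \in Z^1(G,\pi)$ be a $\mu$-harmonic 1-cocycle. (i) If $E$ is a smooth $(p,c_E)$-uniformly convex Banach space ($1<p<\infty$, $c_E>0$), then for every $n \ge 1$: $$\|b\|_{L^p(\mu^{*n})} \ge \big(c_E(n-1)+1\big)^{\frac1p}\, \|b\|_{L^p(\mu)} .$$ (ii) If $E$ is a $(q,d_E)$-uniformly smooth Banach space ($1<q\le 2$, $d_E>0$), then for every $n \ge 1$: $$\|b\|_{L^q(\mu^{*n})} \le \big(d_E(n-1)+1\big)^{\frac1q}\, \|b\|_{L^q(\mu)} .$$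
   Context: Banach spaces are real. $\mathcal{O}(E)$ is the group of linear isometries of $E$; $\pi$ is continuous if $(g,x)\mapsto\pi(g)x$ is continuous. A 1-cocycle for $\pi$ is a continuous map $b:G\to E$ with $b(gh)=b(g)+\pi(g)b(h)$; $Z^1(G,\pi)$ is the space of 1-cocycles. Let $S$ be a compact generating set of $G$, $|g|_S=\min\{n\in\mathbb{N}: g\in S^n\}$, and $m_G$ the Haar measure. A probability measure $\mu$ on $G$ is cohomologically adapted if: $\mu$ is symmetric (invariant under $g\mapsto g^{-1}$); $\mu$ is absolutely continuous with respect to $m_G$; the support of $\mu$ contains $S$; $\inf_{x\in S}\frac{d\mu}{dm_G}(x)>0$; and $\int_G|g|_S^r\,d\mu(g)<\infty$ for every $1\le r<\infty$. $\mu^{*n}$ is the $n$-fold convolution power, and $\|b\|_{L^r(\nu)}=\big(\int_G\|b(g)\|_E^r\,d\nu(g)\big)^{1/r}$. $b$ is $\mu$-harmonic if the Bochner integral $\int_G b(g)\,d\mu(g)$ equals $0$. $E$ is smooth if there is a map $x\mapsto x^*$, $E\to E^*$, uniquely determined by the conditions $\|x^*\|_{E^*}=\|x\|_E$ and $\langle x,x^*\rangle=\|x\|_E^2$ (i.e. every $x$ has a unique such functional $x^*$). A uniquely geodesic complete metric space $(E,d)$ (every two points joined by a unique constant-speed geodesic $t\mapsto x_t$, $t\in[0,1]$) is $(p,c)$-uniformly convex if for all $x_0,x_1,z\in E$, $t\in[0,1]$: $d(z,x_t)^p\le(1-t)d(z,x_0)^p+t\,d(z,x_1)^p-c\,t(1-t)d(x_0,x_1)^p$.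 It is $(q,D)$-uniformly smooth if for all $x_0,x_1,z\in E$, $t\in[0,1]$: $d(z,x_t)^q\ge(1-t)d(z,x_0)^q+t\,d(z,x_1)^q-D\,t(1-t)d(x_0,x_1)^q$. For Banach spaces these are applied to the norm distance, with $x_t=(1-t)x_0+tx_1$. *)

(* Defs.v *)
From HB Require Import structures.
From mathcomp Require Import all_boot all_order all_algebra.
From mathcomp Require Import all_classical all_reals all_analysis.

Set Implicit Arguments.
Unset Strict Implicit.
Unset Printing Implicit Defensive.

Import Order.TTheory GRing.Theory Num.Theory.
Import numFieldNormedType.Exports.

Local Open Scope classical_set_scope.
Local Open Scope ring_scope.

HB.mixin Record isTopologicalGroup G of Group G & Topological G := {
  mulg_continuous : continuous (fun z : G * G => (z.1 * z.2)%g) ;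
  invg_continuous : continuous (fun x : G => x^-1%g)
}.

(* Pointedness is only what the library asks of a measurable type. *)
#[short(type="topologicalGroupType")]
HB.structure Definition TopologicalGroup :=
  {G of Group G & PointedTopological G & isTopologicalGroup G}.

Notation borel G := (g_sigma_algebraType (@open G)).

Section groups.
Context {R : realType} {G : topologicalGroupType}.
Implicit Types (S : set G) (m : {measure set (borel G) -> \bar R}).

Definition generates S := forall H : set G,
  S `<=` H -> H 1%g ->
  (forall x y, H x -> H y -> H (x * y)%g) -> (forall x, H x -> H x^-1%g) ->
  H = [set: G].

Fixpoint set_pow S (n : nat) : set G :=
  if n is k.+1 then [set (x * y)%g | x in S & y in set_pow S k]
  else [set 1%g].

(* The infimum of a nonempty set of naturals is its minimum; the value is +oo
   on the elements that are not a product of elements of S. *)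
Definition word_length S (g : G) : \bar R :=
  ereal_inf [set (n%:R : R)%:E | n in [set n | set_pow S n g]].

Record haar_measure m : Prop := HaarMeasure {
  haar_neq0 : (0 < m [set: G])%E ;
  haar_compact : forall K : set G, compact K -> (m K < +oo)%E ;
  haar_invariant : forall (g : G) (A : set (borel G)), measurable A ->
    m [set h | A (g * h)%g] = m A ;
  haar_outer : forall A : set (borel G), measurable A ->
    m A = ereal_inf [set m U | U in [set U : set G | open U /\ A `<=` U]] ;
  haar_inner : forall U : set G, open U ->
    m U = ereal_sup [set m K | K in [set K : set G | compact K /\ K `<=` U]]
}.

Definition msupport (mu : set (borel G) -> \bar R) : set G :=
  [set x | forall U : set G, open U -> U x -> (0 < mu U)%E].

Definition is_density m (mu : set (borel G) -> \bar R) (f : borel G -> R) :=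
  [/\ measurable_fun setT f, (forall x, 0 <= f x) &
    forall A, measurable A -> mu A = (\int[m]_(x in A) (f x)%:E)%E].

(* A density is only determined almost everywhere: the infimum condition bears
   on some version of it. *)
Record cohomologically_adapted m S (mu : probability (borel G) R) : Prop :=
  CohomologicallyAdapted {
  adapted_symmetric : forall A : set (borel G), measurable A ->
    mu [set g | A g^-1%g] = mu A ;
  adapted_abs_continuous : mu `<< m ;
  adapted_support : S `<=` msupport mu ;
  adapted_density : exists2 f, is_density m mu f &
    (0 < ereal_inf [set (f x)%:E | x in S])%E ;
  adapted_moment : forall r : R, 1 <= r ->
    (\int[mu]_g (word_length S g `^ r) < +oo)%E
}.

(* (mu * nu)(A) = \int nu(g^-1 A) dmu(g). For a group that is not second
   countable the product is in general not measurable for the product of the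
   Borel sigma-algebras, so this is not a pushforward of the product measure. *)
Definition convolution (mu nu : set (borel G) -> \bar R) (A : set (borel G)) :
  \bar R := (\int[mu]_g nu [set h | A (g * h)%g])%E.

Fixpoint convolution_pow (mu : set (borel G) -> \bar R) (n : nat) :
    set (borel G) -> \bar R :=
  if n is k.+1 then convolution (convolution_pow mu k) mu
  else dirac (1%g : borel G).

End groups.

Section bochner.
Context d {T : measurableType d} {R : realType} {E : normedModType R}.
Variable mu : {measure set T -> \bar R}.

Definition simple_map (s : T -> E) := finite_set (range s) /\
  forall v, measurable (s @^-1` [set v]) /\
            (v != 0 -> (mu (s @^-1` [set v]) < +oo)%E).

Definition simple_integral (s : T -> E) : E :=
  \sum_(v \in range s) fine (mu (s @^-1` [set v])) *: v.

Definition has_bochner_integral (f : T -> E) (v : E) :=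
  exists s : nat -> T -> E, [/\ forall n, simple_map (s n),
    {ae mu, forall x, s n x @[n --> \oo] --> f x},
    (\int[mu]_x (`|f x - s n x|)%:E)%E @[n --> \oo] --> 0%E &
    simple_integral (s n) @[n --> \oo] --> v].

End bochner.

Section Lr_norm.
Context d {T : measurableType d} {R : realType} {E : normedModType R}.

(* Stated for set functions, as convolution powers are not bundled measures. *)
Definition Lr_norm (nu : set T -> \bar R) (r : R) (f : T -> E) : \bar R :=
  ((\int[nu]_x (`|f x| `^ r)%:E) `^ r^-1)%E.

End Lr_norm.

Section cocycles.
Context {R : realType} {G : topologicalGroupType} {E : normedModType R}.

(* Each pi g is onto, being inverted by pi g^-1. *)
Record isometric_representation (pi : G -> E -> E) : Prop :=
  IsometricRepresentation {
  rep_linear : forall g, linear (pi g) ;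
  rep_isometry : forall g x, `|pi g x| = `|x| ;
  rep_1 : forall x, pi 1%g x = x ;
  rep_M : forall g h x, pi (g * h)%g x = pi g (pi h x) ;
  rep_continuous : continuous (fun z : G * E => pi z.1 z.2)
}.

Definition cocycle (pi : G -> E -> E) (b : G -> E) :=
  continuous b /\ forall g h, b (g * h)%g = b g + pi g (b h).

Definition mu_harmonic (mu : probability (borel G) R) (b : G -> E) :=
  has_bochner_integral mu (b : borel G -> E) 0.

End cocycles.

Section banach_spaces.
Context {R : realType} (E : normedModType R).

(* The operator norm, for continuous linear f. *)
Definition dual_norm (f : E -> R) : R :=
  sup [set `|f y| | y in [set y : E | `|y| <= 1]].

Definition smooth_space := forall x : E, exists! f : E -> R^o,
  [/\ linear f, continuous f, dual_norm f = `|x| & f x = `|x| ^+ 2].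

Definition uniformly_convex (p c : R) := forall (x0 x1 z : E) (t : R),
  0 <= t <= 1 ->
  `|z - ((1 - t) *: x0 + t *: x1)| `^ p <=
  (1 - t) * `|z - x0| `^ p + t * `|z - x1| `^ p
    - c * t * (1 - t) * `|x0 - x1| `^ p.

Definition uniformly_smooth (q D : R) := forall (x0 x1 z : E) (t : R),
  0 <= t <= 1 ->
  `|z - ((1 - t) *: x0 + t *: x1)| `^ q >=
  (1 - t) * `|z - x0| `^ q + t * `|z - x1| `^ q
    - D * t * (1 - t) * `|x0 - x1| `^ q.

End banach_spaces.

(* Main.v *)
From HB Require Import structures.
Require Import Defs.
From mathcomp Require Import all_boot all_order all_algebra.
From mathcomp Require Import all_classical all_reals all_analysis.
From mathcomp Require Import measurable_realfun ring lra.

Import Order.TTheory GRing.Theory Num.Theory.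
Import numFieldNormedType.Exports.

Local Open Scope classical_set_scope.
Local Open Scope ring_scope.

(** Write b(gh) = b(g) + pi(g) b(h) and let h be distributed according to mu.
    Given g, the second summand has mean zero and the same norm as b(h), so a
    convolution power of mu is the law of a walk whose image under b is a
    martingale.  Everything follows from one inequality per step,

      \int |b(gh)|^p dmu(h) >= |b(g)|^p + c \int |b(h)|^p dmu(h),

    and its reverse for uniform smoothness: integrating it against the law of
    the walk at time n makes the p-th moment grow by at least (at most)
    c |b|_p^p between the times n and n + 1.

    The inequality is the integral of a pointwise one.  Uniform convexity,
    used on segments issued from x whose length tends to zero, gives a bounded
    functional L with |x + y|^p >= |x|^p + L y + c |y|^p for all y
    ([uniformly_convex_support]), where L is a multiple of the norming
    functional x^* that the smoothness of E provides.  Under uniform smoothness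
    the reverse inequality holds with L the derivative of |.|^q at x
    ([uniformly_smooth_support]); uniform smoothness itself shows that the
    one-sided directional derivative exists and is linear.  The function
    h |-> L (pi(g) b(h)) has integral zero because bounded functionals commute
    with the Bochner integral ([bochner_integral_functional]), so that the
    linear term disappears.  It is moved across the inequality by its positive
    and negative parts ([le_integral_mean_zero]), which lets the p-th moments
    be infinite.

    Integrating over the walk requires that convolution powers be measures and
    that \int F d(nu * mu) = \int \int F(gh) dmu(h) dnu(g).  For this the
    function g |-> mu(g^-1 A) has to be Borel for every Borel set A, although
    multiplication need not be measurable for the product of the Borel
    sigma-algebras.  It is where absolute continuity with respect to the Haar
    measure is used: mu inherits the inner regularity of the Haar measure on
    open sets ([compact_inner_approx]), so g |-> mu(g^-1 U) is lower
    semicontinuous for U open ([open_translate_gt]), and a monotone class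
    argument reaches all Borel sets ([measurable_translate]).  Left translates
    of mu then form a probability kernel, and convolution is the composition
    of kernels ([convolution_probability]). *)

(** * Powers of nonnegative reals *)

Section real_powers.
Context {R : realType}.
Implicit Types a r t u : R.

(** This is Young's inequality for the product u * a^(r-1). *)
Lemma powR_tangent r a u : 1 < r -> 0 <= a -> 0 <= u ->
  a `^ r + r * a `^ (r - 1) * (u - a) <= u `^ r.
Proof.
move=> r1 a0 u0; have r0 : 0 < r by lra.
have rB0 : r - 1 != 0 by lra.
have rN0 : r != 0 by lra.
have := @conjugate_powR R u (a `^ (r - 1)) r (r / (r - 1)) u0 (powR_ge0 _ _) r0.
rewrite -powRrM mulrCA mulfV// mulr1.
have -> : (r / (r - 1))^-1 = 1 - r^-1 by field; rewrite rB0 rN0.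
have r'0 : 0 < r / (r - 1) by rewrite divr_gt0//; lra.
have conj : r^-1 + (1 - r^-1) = 1 by rewrite addrC subrK.
move=> /(_ r'0 conj).
have -> : a `^ r = a `^ (r - 1) * a.
  by rewrite -{3}(powRr1 a0) -powRD ?subrK//; apply/implyP; lra.
set k := a `^ (r - 1); set v := u `^ r => young.
have : r * (u * k) <= r * (v / r + k * a * (1 - r^-1)) by rewrite ler_pM2l.
have -> : r * (v / r + k * a * (1 - r^-1)) = v + k * a * (r - 1).
  by field; lra.
by move=> ?; nra.
Qed.

Lemma powR_convex r a u t : 1 <= r -> 0 <= a -> 0 <= u -> 0 <= t <= 1 ->
  ((1 - t) * a + t * u) `^ r <= (1 - t) * a `^ r + t * u `^ r.
Proof.
move=> r1 a0 u0 /andP[t0 t1].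
have := @convex_powR R r r1 (Itv01 t0 t1) u a.
rewrite !inE/= !in_itv/= a0 u0 => /(_ isT isT) h.
by rewrite addrC [leRHS]addrC; exact: h.
Qed.

(** The passage to the limit t -> 0 in an inequality whose error term is a
    multiple of a positive power of t. *)
Lemma ler_vanish a u C r : 0 < r ->
  (forall t, 0 < t <= 2^-1 -> a <= u + C * t `^ r) -> a <= u.
Proof.
move=> r0 h; rewrite leNgt; apply/negP => ua.
have [C0|C0] := leP C 0.
  have := h 2^-1; rewrite lexx andbT invr_gt0 ltr0n => /(_ isT).
  have := mulr_le0_ge0 C0 (powR_ge0 2^-1 r); lra.
(* with t^r <= e the error is at most half of the gap *)
set e := (a - u) / (2 * C).
have e0 : 0 < e by rewrite divr_gt0// ?subr_gt0// mulr_gt0.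
pose t := Num.min 2^-1 (e `^ r^-1).
have t0 : 0 < t by rewrite lt_min invr_gt0 ltr0n powR_gt0.
have := h t; rewrite t0 ge_min lexx => /(_ isT).
have : t `^ r <= e.
  have eE : e = (e `^ r^-1) `^ r.
    by rewrite -powRrM mulVf ?gt_eqF// powRr1// ltW.
  rewrite [leRHS]eE.
  apply: ge0_ler_powR; rewrite ?nnegrE ?powR_ge0 ?(ltW r0) ?(ltW t0)//.
  by rewrite /t ge_min lexx orbT.
move=> /(ler_wpM2l (ltW C0)).
have -> : C * e = (a - u) / 2 by rewrite /e; field; lra.
lra.
Qed.

End real_powers.

(** * First-order bounds for powers of the norm *)

Section norm_support.
Context {R : realType} {E : normedModType R}.

(** L is p |x|^(p-2) x^*: it is below |x + .|^p - |x|^p because x^* is norming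
    and r |-> r^p is above its tangents.  Comparing the tangent at x + t y with
    the uniform convexity inequality on the segment from x to x + y, dividing
    by t and letting t tend to 0 leaves the gain c |y|^p. *)
Lemma uniformly_convex_support (p c : R) (x : E) : 1 < p ->
  smooth_space E -> uniformly_convex E p c ->
  exists L : {linear E -> R^o}, (exists M, forall y, `|L y| <= M * `|y|) /\
    forall y, `|x| `^ p + L y + c * `|y| `^ p <= `|x + y| `^ p.
Proof.
move=> p1 /(_ x)[f [[lf cf df fx] _]] uc.
pose F : {linear E -> R^o} :=
  HB.pack f (GRing.isLinear.Build _ _ _ _ f lf).
have [k [k0 Fk]] : exists k, 0 < k /\ forall y, `|F y| <= k * `|y|.
  have /linear_boundedP/pinfty_ex_gt0[k k0 Fk] : bounded_near F (nbhs (0 : E)).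
    by apply: continuous_linear_bounded; exact: cf.
  by exists k.
have Fx y : `|F y| <= `|x| * `|y|.
  have [->|y0] := eqVneq y 0; first by rewrite linear0 !normr0 mulr0.
  have ny0 : 0 < `|y| by rewrite normr_gt0.
  have : `|F (`|y|^-1 *: y)| <= dual_norm f.
    apply: ub_le_sup; last first.
      exists (`|y|^-1 *: y) => //=.
      by rewrite normrZ normfV normr_id mulVf// gt_eqF.
    exists k => _ [z z1 <-]; apply: (le_trans (Fk z)).
    by rewrite -[leRHS]mulr1 ler_wpM2l// ltW.
  rewrite linearZ /= normrM normfV normr_id df.
  by rewrite mulrC ler_pdivrMr.
pose w := p * `|x| `^ (p - 2).
have w0 : 0 <= w by rewrite mulr_ge0 ?powR_ge0//; lra.
pose L : {linear E -> R^o} := w \*: F.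
have LE y : L y = w * F y by [].
exists L; split.
  exists (w * k) => y.
  by rewrite LE normrM (ger0_norm w0) -[leRHS]mulrA ler_wpM2l.
move=> y; apply: (@ler_vanish _ _ _ (c * `|y| `^ p) 1) => // t /andP[t0 t12].
rewrite powRr1 ?(ltW t0)//.
have tangent : `|x| `^ p + t * L y <= `|x + t *: y| `^ p.
  have [x0|x0] := eqVneq x 0.
    (* here L vanishes, whatever the value of 0^(p-2) *)
    have -> : L y = 0.
      have := Fx y; rewrite x0 normr0 mul0r normr_le0 => /eqP Fy0.
      by rewrite LE Fy0 mulr0.
    by rewrite mulr0 addr0 x0 normr0 powR0 ?powR_ge0//; lra.
  have nx : 0 < `|x| by rewrite normr_gt0.
  apply: le_trans (powR_tangent p _ _ p1 (normr_ge0 x) (normr_ge0 _)).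
  rewrite lerD2l LE /w.
  have -> : p - 1 = p - 2 + 1 by ring.
  rewrite (@powRD _ _ (p - 2) 1); last by rewrite (gt_eqF nx) implybT.
  rewrite powRr1//.
  have := ler_norm (F (x + t *: y)) => /le_trans/(_ (Fx _)).
  rewrite linearD linearZ [F x]fx => Fxty.
  have := ler_wpM2l w0
    (Fxty : `|x| ^+ 2 + t * F y <= `|x| * `|x + t *: y|).
  by rewrite /w; lra.
have t01 : 0 <= t <= 1 by rewrite ltW//=; lra.
have := uc x (x + y) 0 t t01.
have -> : (1 - t) *: x + t *: (x + y) = x + t *: y.
  by rewrite scalerDr scalerBl scale1r addrA subrK.
rewrite !sub0r !normrN opprD addNKr normrN => /(le_trans tangent) h.
suff : t * (`|x| `^ p + L y + c * `|y| `^ p) <=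
       t * (`|x + y| `^ p + c * `|y| `^ p * t) by rewrite ler_pM2l.
lra.
Qed.

(** L y is the limit phi y, as t decreases to 0, of the difference quotients
    D t y of |.|^q at x.  These increase with t by convexity of |.|^q, and
    uniform smoothness bounds their variation on ]0, t] by d |y|^q t^(q-1).
    Hence D 1 y, which is |x + y|^q - |x|^q, exceeds phi y by at most d |y|^q.
    Convexity makes phi subadditive; uniform smoothness at the midpoint of
    x - t y and x + t y gives phi (- y) <= - phi y; together these make phi
    linear. *)
Lemma uniformly_smooth_support (q d : R) (x : E) : 1 < q -> 0 < d ->
  uniformly_smooth E q d ->
  exists L : {linear E -> R^o}, (exists M, forall y, `|L y| <= M * `|y|) /\
    forall y, `|x + y| `^ q <= `|x| `^ q + L y + d * `|y| `^ q.
Proof.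
move=> q1 d0 us; have q10 : 0 < q - 1 by rewrite subr_gt0.
have q0 : 0 < q by lra.
have half1 : 1 = 2^-1 + 2^-1 :> R by lra.
have half01 : 0 <= (2^-1 : R) <= 1 by rewrite invr_ge0 ler0n/=; lra.
have halfC : 1 - 2^-1 = 2^-1 :> R by lra.
pose N (u : E) := `|u| `^ q.
have NZ t u : 0 < t -> N (t *: u) = t * t `^ (q - 1) * N u.
  move=> t0; rewrite /N normrZ gtr0_norm// powRM ?(ltW t0)//.
  rewrite -{2}(powRr1 (ltW t0)) -powRD; last by rewrite (gt_eqF t0) implybT.
  by rewrite addrC subrK.
have NN u : N (- u) = N u by rewrite /N normrN.
have N_convex u v t : 0 <= t <= 1 ->
    N ((1 - t) *: u + t *: v) <= (1 - t) * N u + t * N v.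
  move=> t01; have /andP[t0 t1] := t01.
  apply: le_trans
    (powR_convex q _ _ t (ltW q1) (normr_ge0 u) (normr_ge0 v) t01).
  apply: ge0_ler_powR; rewrite ?nnegrE ?(ltW q0)//.
    by rewrite addr_ge0// mulr_ge0// subr_ge0.
  apply: le_trans (ler_normD _ _) _.
  by rewrite !normrZ (ger0_norm t0) ger0_norm// subr_ge0.
have N_smooth u v t : 0 <= t <= 1 ->
    (1 - t) * N u + t * N v - d * t * (1 - t) * N (u - v)
      <= N ((1 - t) *: u + t *: v).
  by move=> t01; have := us u v 0 t t01; rewrite !sub0r !normrN.
pose D t y := (N (x + t *: y) - N x) / t.
have DE t y : 0 < t -> N (x + t *: y) = N x + t * D t y.
  by move=> t0; rewrite /D mulrCA divff ?gt_eqF// mulr1 [RHS]addrC subrK.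
have combE s y : (1 - s) *: x + s *: (x + y) = x + s *: y.
  by rewrite scalerDr scalerBl scale1r addrA subrK.
have D_mono s t y : 0 < s -> s <= t -> D s y <= D t y.
  move=> s0 st; have t0 : 0 < t by exact: lt_le_trans st.
  have r01 : 0 <= s / t <= 1.
    by rewrite divr_ge0 ?(ltW s0) ?(ltW t0)//= ler_pdivrMr// mul1r.
  have := N_convex x (x + t *: y) _ r01.
  rewrite combE scalerA divfK ?gt_eqF// !DE//.
  have -> : (1 - s / t) * N x + s / t * (N x + t * D t y) = N x + s * D t y.
    by field; lra.
  by rewrite lerD2l ler_pM2l.
have D1_le s y : 0 < s <= 1 -> D 1 y <= D s y + d * (1 - s) * N y.
  move=> /andP[s0 s1].
  have := N_smooth x (x + y) s; rewrite (ltW s0)/= s1 => /(_ isT).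
  rewrite combE opprD addNKr NN DE//.
  have -> : N (x + y) = N x + D 1 y by rewrite -[y in LHS]scale1r DE// mul1r.
  by move=> h; rewrite -(ler_pM2l s0); lra.
have D_scale t a y : 0 < t -> 0 < a -> D t (a *: y) = a * D (t * a) y.
  by move=> t0 a0; rewrite /D scalerA; field; rewrite !gt_eqF.
have D_variation s t y : 0 < s -> s <= t -> t <= 1 ->
    D t y <= D s y + d * N y * t `^ (q - 1).
  move=> s0 st t1; have t0 : 0 < t by exact: lt_le_trans st.
  have r01 : 0 < s / t <= 1 by rewrite divr_gt0//= ler_pdivrMr// mul1r.
  have := D1_le _ (t *: y) r01.
  rewrite NZ// !D_scale//; last by case/andP: r01.
  rewrite mul1r divfK ?gt_eqF// => h.
  rewrite -(ler_pM2l t0) (le_trans h)// [leRHS]mulrDr lerD2l.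
  have -> : t * (d * N y * t `^ (q - 1)) = d * 1 * (t * t `^ (q - 1) * N y).
    by ring.
  rewrite ler_wpM2r//; first by rewrite !mulr_ge0 ?powR_ge0 ?(ltW t0).
  by rewrite ler_wpM2l// ?(ltW d0)// gerBl divr_ge0 ?(ltW s0) ?(ltW t0).
pose phi y := inf [set D t y | t in [set t | 0 < t <= 1]].
have D_lb y t : 0 < t <= 1 -> D 1 y - d * N y <= D t y.
  move=> /andP[t0 t1]; have := D_variation _ _ y t0 t1 (lexx 1).
  by rewrite powR1 mulr1 lerBlDr.
have phi_le t y : 0 < t -> phi y <= D t y.
  move=> t0; have t1 : 0 < Num.min t 1 by rewrite lt_min t0 ltr01.
  apply: (@le_trans _ _ (D (Num.min t 1) y)).
    apply: ge_inf; first by exists (D 1 y - d * N y) => _ [s s01 <-]; exact: D_lb.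
    by exists (Num.min t 1) => //=; rewrite t1 ge_min lexx orbT.
  by rewrite D_mono// ge_min lexx.
have le_phi t y : 0 < t <= 1 -> D t y <= phi y + d * N y * t `^ (q - 1).
  move=> /andP[t0 t1]; rewrite -lerBlDr; apply: lb_le_inf.
    by exists (D 1 y), 1 => //=; rewrite ltr01 lexx.
  move=> _ [s /andP[s0 s1] <-]; rewrite lerBlDr.
  have [st|ts] := leP s t; first exact: D_variation.
  apply: (@le_trans _ _ (D s y)); first by rewrite D_mono// ltW.
  by rewrite lerDl !mulr_ge0 ?powR_ge0 ?(ltW d0).
have phi_subadd y z : phi (y + z) <= phi y + phi z.
  (* x + t (y + z) is the midpoint of x + 2 t y and x + 2 t z *)
  pose C := d * (N y + N z) * 2 `^ (q - 1).
  apply: (@ler_vanish _ _ _ C (q - 1)) => // t /andP[t0 t12].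
  have t2 : 0 < t * 2 <= 1 by rewrite mulr_gt0//=; lra.
  have := N_convex (x + (t * 2) *: y) (x + (t * 2) *: z) _ half01.
  rewrite halfC.
  have -> : 2^-1 *: (x + (t * 2) *: y) + 2^-1 *: (x + (t * 2) *: z)
      = x + t *: (y + z).
    rewrite !scalerDr !scalerA mulrCA mulVf ?pnatr_eq0// mulr1 addrACA.
    by rewrite -scalerDl -half1 scale1r.
  have /andP[t20 _] := t2.
  rewrite !DE// => h.
  have := le_phi _ y t2; have := le_phi _ z t2; have := phi_le _ (y + z) t0.
  rewrite /C powRM ?(ltW t0)//.
  have : D t (y + z) <= D (t * 2) y + D (t * 2) z.
    by rewrite -(ler_pM2l t0); lra.
  lra.
have phiN_le y : phi (- y) <= - phi y.
  rewrite -subr_le0 opprK.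
  pose C := d * 2^-1 * 2 * 2 `^ (q - 1) * N y.
  apply: (@ler_vanish _ _ _ C (q - 1)) => // t /andP[t0 t12].
  have := N_smooth (x + t *: y) (x - t *: y) _ half01.
  rewrite halfC.
  have -> : 2^-1 *: (x + t *: y) + 2^-1 *: (x - t *: y) = x.
    by rewrite !scalerDr addrACA -scalerDl -half1 scale1r scalerN subrr addr0.
  have -> : x + t *: y - (x - t *: y) = (t * 2) *: y.
    by rewrite opprD opprK addrACA subrr add0r -mulr2n -scaler_nat scalerA mulrC.
  rewrite NZ; last by lra.
  rewrite -scalerN !DE// powRM ?(ltW t0)// => h.
  have := phi_le _ y t0; have := phi_le _ (- y) t0.
  suff : D t y + D t (- y) <= C * t `^ (q - 1) by lra.
  by rewrite -(ler_pM2l t0) /C; lra.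
have phiD y z : phi (y + z) = phi y + phi z.
  apply/eqP; rewrite eq_le phi_subadd/=.
  rewrite -lerBrDr; apply: le_trans (lerD (lexx _) (phiN_le z)).
  by rewrite -{1}(addrK z y) phi_subadd.
have phi0 : phi 0 = 0.
  have /eqP := phiD 0 0.
  by rewrite addr0 -subr_eq0 opprD addrA subrr add0r oppr_eq0 => /eqP.
have phiN y : phi (- y) = - phi y.
  by apply/eqP; rewrite -addr_eq0 -phiD addNr phi0.
have phi_pZ_le a y : 0 < a -> phi (a *: y) <= a * phi y.
  move=> a0.
  apply: (@ler_vanish _ _ _ (a * (d * N y)) (q - 1)) => // t /andP[t0 t12].
  have ta : 0 < t / a by rewrite divr_gt0.
  apply: le_trans (phi_le _ (a *: y) ta) _.
  rewrite D_scale// divfK ?gt_eqF// -mulrA -mulrDr ler_pM2l//.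
  by apply: le_phi; rewrite t0/=; lra.
have phi_pZ a y : 0 < a -> phi (a *: y) = a * phi y.
  move=> a0; apply/eqP; rewrite eq_le phi_pZ_le//=.
  have := phi_pZ_le a^-1 (a *: y); rewrite invr_gt0 => /(_ a0).
  by rewrite scalerA mulVf ?gt_eqF// scale1r ler_pdivlMl.
have phiZ a y : phi (a *: y) = a * phi y.
  have [a0|a0|->] := ltgtP a 0; last by rewrite scale0r mul0r.
    by rewrite -[a]opprK scaleNr phiN phi_pZ ?oppr_gt0// [RHS]mulNr.
  exact: phi_pZ.
have phi_linear : linear (phi : E -> R^o) by move=> a y z; rewrite phiD phiZ.
pose L : {linear E -> R^o} :=
  HB.pack (phi : E -> R^o) (GRing.isLinear.Build _ _ _ _ _ phi_linear).
exists L; split; last first.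
  move=> y; have := le_phi 1 y; rewrite ltr01 lexx powR1 => /(_ isT).
  by rewrite /D divr1 scale1r /N -[L y]/(phi y); lra.
(* phi is bounded on the unit ball, since phi y <= D 1 y *)
pose M := (`|x| + 1) `^ q.
have phi_unit y : `|y| <= 1 -> phi y <= M.
  move=> y1; apply: le_trans (phi_le 1 y ltr01) _; rewrite /D divr1 scale1r.
  rewrite lerBlDr (@le_trans _ _ M) ?lerDl ?powR_ge0//.
  apply: ge0_ler_powR; rewrite ?nnegrE ?(ltW q0) ?addr_ge0//.
  by rewrite (le_trans (ler_normD _ _))// lerD2l.
exists M => y; rewrite -[L y]/(phi y).
have [->|y0] := eqVneq y 0; first by rewrite phi0 !normr0 mulr0.
have ny : 0 < `|y| by rewrite normr_gt0.
have : `|phi (`|y|^-1 *: y)| <= M.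
  have n1 : `|(`|y|^-1 *: y)| <= 1.
    by rewrite normrZ normfV normr_id mulVf ?normr_eq0.
  by rewrite ler_norml phi_unit// andbT lerNl -phiN phi_unit// normrN.
by rewrite phiZ normrM normfV normr_id mulrC ler_pdivrMr.
Qed.

End norm_support.

(** * Bounded functionals and the Bochner integral *)

Lemma measurable_simple_comp d {T : measurableType d} {R : realType}
    {E : normedModType R} (mu : {measure set T -> \bar R})
    (s : T -> E) (h : E -> T -> R) : simple_map mu s ->
  (forall v, measurable_fun setT (h v)) ->
  measurable_fun setT (fun x => h (s x) x).
Proof.
move=> [fs ms] mh _ B mB; rewrite setTI.
have -> : (fun x => h (s x) x) @^-1` B =
    \bigcup_(v in range s) (s @^-1` [set v] `&` h v @^-1` B).
  apply/seteqP; split => [x Bx|x [_ [y _ <-]] [/= -> //]].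
  by exists (s x) => //; exists x.
apply: fin_bigcup_measurable => // v _.
apply: measurableI; first exact: (ms v).1.
by rewrite -[X in measurable X]setTI; exact: mh.
Qed.

(** The identity is clear for simple maps, and both sides are continuous for
    the L^1 distance of f to the approximating simple maps.  Measurability is
    asked of scalar functions built from f, since sums of Borel maps into E need
    not be Borel when E is not separable. *)
Lemma bochner_integral_functional d {T : measurableType d} {R : realType}
    {E : normedModType R} (mu : {finite_measure set T -> \bar R})
    (f : T -> E) (v : E) (L : {linear E -> R^o}) (M : R) :
  (forall w, measurable_fun setT (fun x => `|f x - w|)) ->
  measurable_fun setT (fun x => L (f x) : R) ->
  (forall y, `|L y| <= M * `|y|) ->
  has_bochner_integral mu f v ->
  mu.-integrable setT (fun x => (L (f x) : R)%:E) /\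
  (\int[mu]_x (L (f x) : R)%:E)%E = (L v : R)%:E.
Proof.
move=> mfw mLf LM [s [ss _ fs sv]].
(* a nonnegative bound; M may be negative when E is trivial *)
have M0 : 0 <= Num.max M 0 by rewrite le_max lexx orbT.
have {}LM y : `|L y| <= Num.max M 0 * `|y|.
  by rewrite (le_trans (LM y))// ler_wpM2r// le_max lexx.
move: (Num.max M 0) M0 LM => {}M M0 LM.
have mfs n : measurable_fun setT (fun x => `|f x - s n x|).
  exact: (@measurable_simple_comp _ _ _ _ mu (s n) (fun v x => `|f x - v|)).
have L_simple n : mu.-integrable setT (fun x => (L (s n x) : R)%:E) /\
    (\int[mu]_x (L (s n x) : R)%:E)%E = (L (simple_integral mu (s n)) : R)%:E.
  have [fin_s ms] := ss n.
  pose r : seq E := finmap.enum_fset (fset_set (range (s n))).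
  have LsE : (fun x => (L (s n x) : R)%:E) = (fun x => \sum_(w <- r)
      ((L w : R)%:E * (\1_(s n @^-1` [set w]) x)%:E)%E)%E.
    apply/funext => x.
    rewrite (bigD1_seq (s n x)) ?finmap.fset_uniq//=; last first.
      by rewrite in_fset_set// inE; exists x.
    rewrite indicE mem_set// mule1 big1 ?adde0// => w ws.
    by rewrite indicE memNset ?mule0//= => sw; rewrite sw eqxx in ws.
  have int_w w : mu.-integrable setT
      (fun x => ((L w : R)%:E * (\1_(s n @^-1` [set w]) x)%:E)%E).
    by apply: integrableZl => //; apply: integrable_indic; exact: (ms w).1.
  rewrite LsE; split; first exact: integrable_sum.
  rewrite integral_sum// /simple_integral fsbig_finite//= linear_sum/= -sumEFin.
  apply: eq_bigr => w _; rewrite integralZl//; last first.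
    by apply: integrable_indic; exact: (ms w).1.
  rewrite integral_indic ?setIT//; last exact: (ms w).1.
  rewrite linearZ/= muleC EFinM fineK//.
  by apply: fin_num_measure; exact: (ms w).1.
have /fine_cvgP[D_fin /cvgrPdist_lt D0] := fs.
have close t : 0 < t ->
    (`|\int[mu]_x (L (f x) : R)%:E - (L v : R)%:E| <= (2 * M * t)%:E)%E /\
    mu.-integrable setT (fun x => (L (f x) : R)%:E).
  move=> t0.
  have D0' := D0 _ t0; have /cvgrPdist_lt/(_ _ t0) sv' := sv.
  near \oo => n.
  have Dn : (\int[mu]_x (`|f x - s n x|)%:E <= t%:E)%E.
    have fin_Dn : (\int[mu]_x (`|f x - s n x|)%:E)%E \is a fin_num by near: n.
    rewrite -(fineK fin_Dn) lee_fin -[leLHS]subr0 ltW//.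
    apply: le_lt_trans (ler_norm _) _; rewrite -normrN opprB.
    by near: n.
  have svn : `|v - simple_integral mu (s n)| < t by near: n.
  have [int_s int_sE] := L_simple n.
  have m_diff : measurable_fun setT (fun x => (L (f x) - L (s n x) : R)).
    apply: measurable_funB => //.
    by have := measurable_int _ int_s => /measurable_EFinP.
  have int_diff_le :
      (\int[mu]_x `|(L (f x) - L (s n x) : R)%:E| <= (M * t)%:E)%E.
    apply: (@le_trans _ _ (\int[mu]_x (M%:E * (`|f x - s n x|)%:E))%E).
      apply: ge0_le_integral => //.
      - by apply/measurable_EFinP; apply: measurableT_comp.
      - by apply/measurable_EFinP; apply: measurable_funM.
      - by move=> x _; rewrite -EFinM lee_fin -linearB.
    rewrite ge0_integralZl_EFin//; last exact/measurable_EFinP.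
    by rewrite EFinM lee_wpmul2l.
  have int_diff : mu.-integrable setT (fun x => (L (f x) - L (s n x) : R)%:E).
    apply/integrableP; split; first exact/measurable_EFinP.
    by apply: le_lt_trans int_diff_le _; rewrite ltry.
  have int_f : mu.-integrable setT (fun x => (L (f x) : R)%:E).
    apply: eq_integrable (integrableD measurableT int_diff int_s) => //.
    by move=> x _ /=; rewrite -EFinD subrK.
  split=> //.
  have -> : (\int[mu]_x (L (f x) : R)%:E - (L v : R)%:E =
     \int[mu]_x (L (f x) - L (s n x) : R)%:E
       - (L (v - simple_integral mu (s n)) : R)%:E)%E.
    under [in RHS]eq_integral do rewrite EFinB.
    rewrite integralB// int_sE linearB.
    have := integrable_fin_num measurableT int_f.
    by case: (integral _ _ _) => // a _; rewrite -!EFinB; congr EFin; ring.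
  apply: le_trans (lee_abs_sub _ _) _.
  have -> : 2 * M * t = M * t + M * t by ring.
  rewrite EFinD leeD//.
    apply: le_trans int_diff_le; apply: le_abse_integral => //.
    exact/measurable_EFinP.
  by rewrite lee_fin (le_trans (LM _))// ler_wpM2l// ltW.
have [_ int_f] := close 1 ltr01; split=> //.
have := integrable_fin_num measurableT int_f.
move: close; case: (integral _ _ _) => // a close _.
congr EFin; apply/eqP; rewrite -subr_eq0 -normr_le0.
apply: (@ler_vanish _ _ _ (2 * M) 1) => // t /andP[t0 _].
by have [] := close t t0; rewrite -EFinB lee_fin add0r powRr1// ltW.
Unshelve. all: by end_near. Qed.

(** * Inner regularity of absolutely continuous measures *)

Lemma lt_measure_bigcup d {T : measurableType d} {R : realType}
    (mu : {measure set T -> \bar R}) (F : nat -> set T) (a : \bar R) :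
  (forall n, measurable (F n)) -> nondecreasing_seq F ->
  (a < mu (\bigcup_n F n))%E -> exists n, (a < mu (F n))%E.
Proof.
move=> mF ndF aF; apply/not_existsP => h; move: aF; apply/negP; rewrite -leNgt.
have cF := @nondecreasing_cvg_mu _ _ _ mu F mF
  (bigcup_measurable (fun n _ => mF n)) ndF.
rewrite -(cvg_lim _ cF)//; apply: lime_le.
  by apply/cvg_ex; exists (mu (\bigcup_n F n)); exact: cF.
by apply: nearW => n; rewrite leNgt; apply/negP; exact: h.
Qed.

Section regularity.
Context {R : realType} {G : topologicalGroupType}.

Lemma measurable_open (U : set G) : open U -> measurable (U : set (borel G)).
Proof. by move=> oU; exact: sub_sigma_algebra. Qed.

Lemma measurable_compact (K : set G) : hausdorff_space G -> compact K ->
  measurable (K : set (borel G)).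
Proof.
move=> hG cK; have oK : open (~` K).
  by apply: closed_openC; exact: compact_closed.
by have := measurableC (measurable_open _ oK); rewrite setCK.
Qed.

(** The Haar measure is inner regular only on open sets, and it need not be
    sigma-finite on U.  So U is first cut down to a set {f >= 1/k}, which has
    finite Haar measure, then enlarged to an open set W of finite Haar measure
    by outer regularity; countably many compact subsets of W exhaust W up to a
    Haar-null, hence mu-null, set. *)
Lemma compact_inner_approx (m : {measure set (borel G) -> \bar R})
    (mu : probability (borel G) R) (f : borel G -> R) (U : set G) (a : \bar R) :
  hausdorff_space G -> haar_measure m -> mu `<< m -> is_density m mu f ->
  open U -> (a < mu U)%E ->
  exists K : set G, [/\ compact K, K `<=` U & (a < mu K)%E].
Proof.
move=> hG hm ac [mf f0 muf] oU aU.
have mU := measurable_open _ oU.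
pose B k : set (borel G) := U `&` [set x | k.+1%:R^-1 <= f x].
have mB k : measurable (B k).
  apply: measurableI => //.
  rewrite -[X in measurable X]setTI.
  have -> : [set x | k.+1%:R^-1 <= f x] = f @^-1` `[k.+1%:R^-1, +oo[%classic.
    by apply/seteqP; split => x /=; rewrite in_itv/= andbT.
  by apply: mf => //; exact: measurable_itv.
have ndB : nondecreasing_seq B.
  move=> i j ij; apply/subsetPset; apply: setIS => x /=; apply: le_trans.
  by rewrite lef_pV2 ?posrE ?ltr0n// ler_nat.
have muB : mu (\bigcup_k B k) = mu U.
  have sBU : \bigcup_k B k `<=` U by apply: bigcup_sub => k _; exact: subIsetl.
  have mcB : measurable (\bigcup_k B k) by exact: bigcup_measurable.
  apply/eqP; rewrite eq_le le_measure ?inE//=.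
  have UE : U = (\bigcup_k B k) `|` (U `\` \bigcup_k B k) by rewrite setDUK.
  rewrite [X in (mu X <= _)%E]UE.
  apply: le_trans (measureU2 _ _ _) _ => //; first exact: measurableD.
  rewrite [X in (_ + X)%E](_ : _ = 0%E) ?adde0//.
  apply: etrans (muf _ (measurableD mU mcB)) _.
  apply: integral0_eq => x [Ux nB]; congr EFin; apply/eqP.
  rewrite eq_le f0 andbT leNgt; apply/negP => fx; apply: nB.
  have [k kx] := ltr_add_invr (fx : 0 < f x).
  by rewrite add0r in kx; exists k => //; split => //=; exact: ltW.
have [k akB] : exists k, (a < mu (B k))%E.
  have aB : (a < mu (\bigcup_k B k))%E by rewrite muB.
  exact: (@lt_measure_bigcup _ _ _ mu _ _ mB ndB aB).
have mBk : (m (B k) < +oo)%E.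
  have k0 : 0 < k.+1%:R^-1 :> R by rewrite invr_gt0 ltr0n.
  have : ((k.+1%:R^-1)%:E * m (B k) <= 1)%E.
    rewrite -integral_cst//; apply: le_trans (probability_le1 mu (mB k)).
    apply: le_trans; last by rewrite (muf _ (mB k)).
    apply: ge0_le_integral => //.
    - by move=> x _; rewrite lee_fin ltW.
    - by apply/measurable_EFinP; apply: measurable_funS mf.
    - by move=> x [_ /=]; rewrite lee_fin.
  case: (m (B k)) => [r _| |]; rewrite ?ltry//.
  by rewrite gt0_muley// leye_eq.
have [V [oV BV mV]] : exists V : set G,
    [/\ open V, B k `<=` V & (m V < +oo)%E].
  move: mBk; rewrite (haar_outer hm)// => /ereal_inf_lt[_ [V [oV BV] <-] mV].
  by exists V.
pose W := V `&` U; have oW : open W by exact: openI.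
have mW := measurable_open _ oW.
have mW_fin : (m W < +oo)%E.
  apply: le_lt_trans mV; apply: le_measure; rewrite ?inE//.
    exact: measurable_open.
  exact: subIsetl.
have aW : (a < mu W)%E.
  apply: lt_le_trans akB _; apply: le_measure; rewrite ?inE//.
  by move=> x Bx; split; [exact: BV|case: Bx].
have mWn : m W \is a fin_num by rewrite ge0_fin_numE.
have /choice[K Kn] : forall n, exists K : set G,
    [/\ compact K, K `<=` W & (m W - (n.+1%:R^-1)%:E < m K)%E].
  move=> n; have : (m W - (n.+1%:R^-1)%:E < m W)%E.
    by rewrite lteBlDr// lteDl// lte_fin invr_gt0 ltr0n.
  rewrite [X in (_ < X)%E](haar_inner hm)//.
  by move=> /ereal_sup_gt[_ [K [cK KW] <-] ?]; exists K.
have cK n : compact (K n) by case: (Kn n).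
have KW n : K n `<=` W by case: (Kn n).
have mK n := measurable_compact _ hG (cK n).
pose L n := \big[setU/set0]_(i < n.+1) K i.
have LE : \bigcup_n L n = \bigcup_n K n by exact: bigcup_bigsetU_bigcup.
have mcK : measurable (\bigcup_n K n : set (borel G)).
  exact: bigcup_measurable.
have cKW : \bigcup_n K n `<=` W by apply: bigcup_sub => n _; exact: KW.
have mDW0 : m (W `\` \bigcup_n K n) = 0%E.
  apply/eqP; rewrite eq_le measure_ge0 andbT; apply/lee_addgt0Pr => e e0.
  rewrite add0e.
  have [n ne] := ltr_add_invr (e0 : 0 < e).
  apply: (@le_trans _ _ (m (W `\` K n))).
    apply: le_measure; rewrite ?inE; [exact: measurableD|exact: measurableD|].
    by apply: setDS; exact: bigcup_sup.
  rewrite measureD// (setIidr (KW n)).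
  have [_ _ h] := Kn n.
  rewrite leeBlDr; last first.
    by rewrite ge0_fin_numE// (le_lt_trans _ mW_fin)// le_measure ?inE.
  move: h; rewrite lteBlDr// => /ltW/le_trans; apply.
  by rewrite addeC leeD2r// lee_fin ltW//; rewrite add0r in ne.
have muL : mu (\bigcup_n L n) = mu W.
  rewrite LE; apply/eqP; rewrite eq_le le_measure ?inE//=.
  have WE : W = (\bigcup_k K k) `|` (W `\` \bigcup_k K k) by rewrite setDUK.
  rewrite [X in (mu X <= _)%E]WE.
  apply: le_trans (measureU2 _ _ _) _ => //; first exact: measurableD.
  rewrite [X in (_ + X)%E](_ : _ = 0%E) ?adde0//.
  have mDW := measurableD mW mcK.
  have nullW : m.-null_set (W `\` \bigcup_n K n).
    apply: negligible_null_set; exists (W `\` \bigcup_n K n).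
    by split; [exact: mDW|exact: mDW0|exact: subset_refl].
  exact: (ac _ nullW _ mDW).
have mL n : measurable (L n : set (borel G)).
  by apply: bigsetU_measurable => i _; exact: mK.
have ndL : nondecreasing_seq L.
  by move=> i j ij; apply/subsetPset; exact: subset_bigsetU.
have [n aLn] : exists n, (a < mu (L n))%E.
  have aL : (a < mu (\bigcup_n L n))%E by rewrite muL.
  exact: (@lt_measure_bigcup _ _ _ mu _ _ mL ndL aL).
exists (L n); split => //; first exact: bigsetU_compact.
by move=> x; rewrite /L -bigcup_mkord => -[i _ /KW[]].
Qed.

End regularity.

(** * Borel measurability of the measure of a translate *)

Section translation.
Context {R : realType} {G : topologicalGroupType}.

Lemma measurable_fun_lsc (F : borel G -> \bar R) :
  (forall a : R, open ([set g | a%:E < F g]%E : set G)) ->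
  measurable_fun setT F.
Proof.
move=> oF; apply: (measurability _ (ErealGenOInfty.measurableE R)) => //.
move=> _ [_ [a ->] <-]; rewrite setTI; apply: sub_sigma_algebra.
rewrite [X in open X](_ : _ = [set g | a%:E < F g]%E)//.
by apply/seteqP; split => x /=; rewrite in_itv/= andbT.
Qed.

Lemma measurable_fun_continuous (F : G -> R) : continuous F ->
  measurable_fun setT (F : borel G -> R).
Proof.
move=> cF; apply/measurable_EFinP; apply: measurable_fun_lsc => a.
rewrite [X in open X](_ : _ = F @^-1` [set x | a < x])//.
by apply: open_comp => //; exact: open_gt.
Qed.

Lemma continuous_mulg_l (g : G) : continuous (fun h : G => (g * h)%g).
Proof.
move=> h; apply: (@continuous_comp _ _ _ (fun h : G => (g, h))
  (fun z => (z.1 * z.2)%g)); last exact: mulg_continuous.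
by apply: cvg_pair; [exact: cvg_cst|exact: cvg_id].
Qed.

Lemma measurable_fun_mulg_l (g : G) :
  measurable_fun setT (fun h : borel G => (g * h)%g : borel G).
Proof.
apply: (@measurability _ _ (borel G) (borel G) _ _ (@open G)) => //.
move=> _ [U oU <-]; rewrite setTI; apply: sub_sigma_algebra.
by apply: open_comp => // h _; exact: continuous_mulg_l.
Qed.

Lemma measurable_mulg_l_preimage (g : G) (A : set (borel G)) :
  measurable A -> measurable ([set h | A (g * h)%g] : set (borel G)).
Proof.
by move=> mA; rewrite -[X in measurable X]setTI; exact: measurable_fun_mulg_l.
Qed.

Lemma open_of_nbhs (W : set G) : (forall g, W g -> nbhs g W) -> open W.
Proof. by rewrite openE. Qed.

(** If K is a compact subset of g^-1 U, then g' K is contained in U for all g'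
    near g; so a lower bound on mu (g^-1 U) that is witnessed by a compact set
    persists near g. *)
Lemma open_translate_gt (mu : {measure set (borel G) -> \bar R}) (U : set G)
    (a : \bar R) :
  hausdorff_space G ->
  (forall V : set G, open V -> (a < mu V)%E ->
     exists K : set G, [/\ compact K, K `<=` V & (a < mu K)%E]) ->
  open U -> open ([set g | a < mu [set h | U (g * h)%g]]%E : set G).
Proof.
move=> hG inner_mu oU; apply: open_of_nbhs => g /= ag.
have oV : open [set h | U (g * h)%g].
  by apply: open_comp => // h _; exact: continuous_mulg_l.
have [K [cK KV aK]] := inner_mu _ oV ag.
have : \forall g' \near g, K `<=` [set h | U (g' * h)%g].
  move/compact_near_coveringP : (cK); apply=> x /KV /= Ux.
  have := mulg_continuous (g, x) U (open_nbhs_nbhs (conj oU Ux)).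
  move=> [[A B] /= [nA nB] AB]; exists (B, A) => //= -[y g'] [By Ag'].
  exact: (AB (g', y)).
apply: filterS => g' KU; apply: lt_le_trans aK _.
apply: le_measure; rewrite ?inE//; first exact: measurable_compact.
by apply: measurable_mulg_l_preimage; exact: measurable_open.
Qed.

Lemma measurable_translate (mu : {finite_measure set (borel G) -> \bar R}) :
  (forall U : set G, open U ->
    measurable_fun setT (fun g : borel G => mu [set h | U (g * h)%g])) ->
  forall A : set (borel G), measurable A ->
    measurable_fun setT (fun g : borel G => mu [set h | A (g * h)%g]).
Proof.
move=> mU.
pose H := [set A : set (borel G) | measurable A /\
  measurable_fun setT (fun g : borel G => mu [set h | A (g * h)%g])].
suff : @measurable _ (borel G) `<=` H by move=> mH A /mH[].
apply: lambda_system_subset => //.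
- by move=> A B oA oB; exact: openI.
- split=> //.
  + split; first exact: measurableT.
    by apply: mU; exact: openT.
  + move=> A B BA [mA hA] [mB hB]; split; first exact: measurableD.
    rewrite (_ : (fun _ => _) =
      (fun g : borel G => mu [set h | A (g * h)%g] - mu [set h | B (g * h)%g])%E).
      exact: emeasurable_funB.
    apply/funext => g.
    have -> : [set h | (A `\` B) (g * h)%g] =
       [set h | A (g * h)%g] `\` [set h | B (g * h)%g] by [].
    rewrite measureD; [|exact: measurable_mulg_l_preimage..|].
      by rewrite setIidr// => h /BA.
    rewrite ltey_eq fin_num_measure//.
    exact: measurable_mulg_l_preimage.
  + move=> F ndF HF; have mF n := (HF n).1.
    split; first exact: bigcup_measurable.
    apply: (emeasurable_fun_cvg
      (fun n (g : borel G) => mu [set h | F n (g * h)%g])).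
      by move=> n; exact: (HF n).2.
    move=> g _; rewrite (_ : [set h | _] = \bigcup_n [set h | F n (g * h)%g])//.
    apply: nondecreasing_cvg_mu.
    - by move=> n; exact: measurable_mulg_l_preimage.
    - by apply: bigcup_measurable => n _; exact: measurable_mulg_l_preimage.
    - by move=> i j /ndF/subsetPset Fij; apply/subsetPset => h /Fij.
- by move=> U oU; split; [exact: measurable_open|exact: mU].
Qed.

End translation.

(** * Convolution as composition with the translation kernel *)

Section convolution_probability.
Context {R : realType} {G : topologicalGroupType}.
Variables (P mu : probability (borel G) R).

Definition ltranslate (g : borel G) (A : set (borel G)) : \bar R :=
  mu [set h | A (g * h)%g].

Section measure.
Variable g : borel G.

Let ltranslate0 : ltranslate g set0 = 0%E.
Proof. exact: measure0. Qed.

Let ltranslate_ge0 A : (0 <= ltranslate g A)%E.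
Proof. exact: measure_ge0. Qed.

Let ltranslate_sigma_additive : semi_sigma_additive (ltranslate g).
Proof.
move=> F mF tF mUF.
apply: (@measure_semi_sigma_additive _ _ _ mu
  (fun n => [set h | F n (g * h)%g])).
- by move=> n; exact: measurable_mulg_l_preimage.
- by move=> i j _ _ [h Fh]; apply: tF => //; exists (g * h)%g.
- exact: measurable_mulg_l_preimage mUF.
Qed.

HB.instance Definition _ := isMeasure.Build _ _ _ (ltranslate g)
  ltranslate0 ltranslate_ge0 ltranslate_sigma_additive.

End measure.

Hypothesis measurable_ltranslate : forall A : set (borel G), measurable A ->
  measurable_fun setT (ltranslate ^~ A).

Lemma integral_ltranslate (g : borel G) (F : borel G -> \bar R) :
  (forall x, 0 <= F x)%E -> measurable_fun setT F ->
  (\int[ltranslate g]_x F x = \int[mu]_h F (g * h)%g)%E.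
Proof.
move=> F0 mF.
by apply: (@ge0_integral_pushforward _ _ _ _ _ _
  (measurable_fun_mulg_l g) mu setT F).
Qed.

Lemma measurable_integral_ltranslate (F : borel G -> \bar R) :
  (forall x, 0 <= F x)%E -> measurable_fun setT F ->
  measurable_fun setT (fun g : borel G => \int[mu]_h F (g * h)%g)%E.
Proof.
move=> F0 mF; under eq_fun do rewrite -integral_ltranslate//.
exact: (@measurable_fun_integral_kernel _ _ _ _ R ltranslate).
Qed.

(** Composition of kernels lets the second kernel depend on the source of the
    first one; the source is here a one-point space. *)
Let translation_kernel (z : unit * borel G) :
  {measure set (borel G) -> \bar R} := ltranslate z.2.

Let measurable_translation_kernel U : measurable U ->
  measurable_fun setT (translation_kernel ^~ U).
Proof.
by move=> mU; exact: measurableT_comp (measurable_ltranslate _ mU) _.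
Qed.

HB.instance Definition _ := isKernel.Build _ _ _ _ R
  translation_kernel measurable_translation_kernel.

Let translation_kernelT z : translation_kernel z setT = 1%E.
Proof. exact: (@probability_setT _ _ _ mu). Qed.

HB.instance Definition _ := Kernel_isProbability.Build _ _ _ _ R
  translation_kernel translation_kernelT.

Let const_kernel (_ : unit) : {measure set (borel G) -> \bar R} := P.

Let measurable_const_kernel U : measurable U ->
  measurable_fun setT (const_kernel ^~ U).
Proof. by move=> mU; exact: measurable_cst. Qed.

HB.instance Definition _ := isKernel.Build _ _ _ _ R
  const_kernel measurable_const_kernel.

Let const_kernelT z : const_kernel z setT = 1%E.
Proof. exact: (@probability_setT _ _ _ P). Qed.

HB.instance Definition _ := Kernel_isProbability.Build _ _ _ _ R
  const_kernel const_kernelT.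

Let convolution_measure : set (borel G) -> \bar R :=
  kcomp const_kernel translation_kernel tt.

HB.instance Definition _ := Measure.on convolution_measure.

Let convolution_measureT : convolution_measure setT = 1%E.
Proof.
rewrite /convolution_measure /= /kcomp.
under eq_integral do rewrite translation_kernelT.
by rewrite integral_cst// mul1e; exact: (@probability_setT _ _ _ P).
Qed.

HB.instance Definition _ :=
  Measure_isProbability.Build _ _ _ convolution_measure convolution_measureT.

Lemma convolution_probability : exists Q : probability (borel G) R,
  (forall A, measurable A -> Q A = convolution P mu A) /\
  forall F : borel G -> \bar R,
    (forall x, 0 <= F x)%E -> measurable_fun setT F ->
    (\int[Q]_x F x = \int[P]_g \int[mu]_h F (g * h)%g)%E.
Proof.
exists convolution_measure; split=> // F F0 mF.
apply: etrans (@integral_kcomp _ _ _ _ _ _ R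
  const_kernel translation_kernel tt F F0 mF) _.
by apply: eq_integral => g _ /=; exact: integral_ltranslate.
Qed.

End convolution_probability.

Section set_function.
Import HBNNSimple.

(** Convolution powers are bare set functions, which agree with measures
    on Borel sets; their integrals are computed by this replacement. *)
Lemma eq_integral_set_function d {T : measurableType d} {R : realType}
    (nu1 nu2 : set T -> \bar R) (f : T -> \bar R) :
  (forall A, measurable A -> nu1 A = nu2 A) ->
  (\int[nu1]_x f x = \int[nu2]_x f x)%E.
Proof.
move=> nu12.
have sE (h : {nnsfun T >-> R}) : sintegral nu1 h = sintegral nu2 h.
  by apply: eq_fsbigr => r _; rewrite nu12.
rewrite /integral; congr (ereal_sup _ - ereal_sup _)%E.
  by apply/seteqP; split=> _ [h hf <-]; exists h.
by apply/seteqP; split=> _ [h hf <-]; exists h.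
Qed.

End set_function.

Lemma convolution_pow_probability {R : realType} {G : topologicalGroupType}
    (mu : probability (borel G) R) :
  (forall A : set (borel G), measurable A ->
    measurable_fun setT (ltranslate mu ^~ A)) ->
  exists Q : nat -> probability (borel G) R,
  [/\ forall n A, measurable A -> convolution_pow mu n A = Q n A,
      forall F : borel G -> \bar R, measurable_fun setT F ->
        (\int[Q 0%N]_x F x = F 1%g)%E &
      forall n (F : borel G -> \bar R), (forall x, 0 <= F x)%E ->
        measurable_fun setT F ->
        (\int[Q n.+1]_x F x = \int[Q n]_g \int[mu]_h F (g * h)%g)%E].
Proof.
move=> mtrans.
have /choice[step stepP] := fun P => convolution_probability P mu mtrans.
exists (fun n => iter n step (\d_ (1%g : borel G))); split.
- elim=> [//|n IHn] A mA.
  rewrite /= (stepP _).1// /convolution.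
  exact: eq_integral_set_function.
- by move=> F mF; rewrite integral_dirac// diracT mul1e.
- by move=> n F F0 mF; exact: (stepP _).2.
Qed.

Lemma measurable_ltranslate_adapted (R : realType) (G : topologicalGroupType)
    (m : {measure set (borel G) -> \bar R}) (S : set G)
    (mu : probability (borel G) R) :
  hausdorff_space G -> haar_measure m -> cohomologically_adapted m S mu ->
  forall A : set (borel G), measurable A ->
    measurable_fun setT (ltranslate mu ^~ A).
Proof.
move=> hG hm adm; apply: measurable_translate => U oU.
have [f df _] := adapted_density adm.
apply: measurable_fun_lsc => a; apply: open_translate_gt => // V oV aV.
exact: compact_inner_approx hG hm (adapted_abs_continuous adm) df oV aV.
Qed.

(** * One step of the walk *)

(** Nothing is subtracted from u and v, whose integrals may be infinite: only
    the finite integrals of the positive and negative parts of l cancel. *)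
Lemma le_integral_mean_zero d {T : measurableType d} {R : realType}
    (mu : {measure set T -> \bar R}) (u v l : T -> R) :
  (forall x, 0 <= u x) -> (forall x, 0 <= v x) ->
  measurable_fun setT u -> measurable_fun setT v ->
  mu.-integrable setT (fun x => (l x)%:E) -> (\int[mu]_x (l x)%:E = 0)%E ->
  (forall x, u x + l x <= v x) ->
  (\int[mu]_x (u x)%:E <= \int[mu]_x (v x)%:E)%E.
Proof.
move=> u0 v0 mu_ mv il l0 ulv.
pose L x := (l x)%:E.
have mL : measurable_fun setT L := measurable_int _ il.
have fLp : (\int[mu]_x (L^\+)%E x)%E \is a fin_num.
  exact: integrable_pos_fin_num.
have fLn : (\int[mu]_x (L^\-)%E x)%E \is a fin_num.
  exact: integrable_neg_fin_num.
have eL : (\int[mu]_x (L^\+)%E x = \int[mu]_x (L^\-)%E x)%E.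
  move: l0; rewrite integralE => /eqP.
  by rewrite sube_eq ?add0e ?fin_num_adde_defl// => /eqP.
have mu' : measurable_fun setT (fun x => (u x)%:E) by exact/measurable_EFinP.
have mv' : measurable_fun setT (fun x => (v x)%:E) by exact/measurable_EFinP.
have mLp : measurable_fun setT (L^\+)%E by exact: measurable_funepos.
have mLn : measurable_fun setT (L^\-)%E by exact: measurable_funeneg.
have u0' x : setT x -> (0 <= (u x)%:E)%E by rewrite lee_fin.
have v0' x : setT x -> (0 <= (v x)%:E)%E by rewrite lee_fin.
rewrite -(leeD2rE _ _ fLp) {2}eL -!ge0_integralD//.
apply: ge0_le_integral => //.
- by move=> x _; rewrite adde_ge0// lee_fin.
- exact: emeasurable_funD.
- exact: emeasurable_funD.
move=> x _; rewrite funeposE funenegE /L -EFinN -!EFin_max -!EFinD lee_fin.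
have := ulv x; have [|] := leP (l x) 0; have [|] := leP (- l x) 0; lra.
Qed.

Section harmonic.
Context {R : realType} {G : topologicalGroupType} {E : normedModType R}.
Variables (mu : probability (borel G) R) (pi : G -> E -> E) (b : G -> E).
Hypotheses (rep_pi : isometric_representation pi) (cocycle_b : cocycle pi b)
  (harmonic_b : mu_harmonic mu b).

Lemma measurable_norm_cocycle (r : R) (g : G) :
  measurable_fun setT (fun h : borel G => `|b (g * h)%g| `^ r).
Proof.
apply: (measurableT_comp (measurable_powR _)).
apply: (measurable_fun_continuous (fun h => `|b (g * h)%g|)) => h.
apply: cvg_norm; apply: (@continuous_comp _ _ _ (fun h : G => (g * h)%g) b).
  exact: continuous_mulg_l.
exact: cocycle_b.1.
Qed.

Lemma harmonic_functional (L : {linear E -> R^o}) (M : R) (g : G) :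
  (forall y, `|L y| <= M * `|y|) ->
  mu.-integrable setT (fun h => (L (pi g (b h)) : R)%:E) /\
  (\int[mu]_h (L (pi g (b h)) : R)%:E = 0)%E.
Proof.
move=> LM.
pose P : {linear E -> E} :=
  HB.pack (pi g) (GRing.isLinear.Build _ _ _ _ _ (rep_linear rep_pi g)).
pose K : {linear E -> R^o} := L \o P.
have KM y : `|K y| <= M * `|y|.
  by rewrite -(rep_isometry rep_pi g y); exact: LM.
have cK : continuous K.
  apply: bounded_linear_continuous; apply/linear_boundedP.
  exists M; split=> [|r Mr y]; first exact: num_real.
  by apply: le_trans (KM y) _; rewrite ler_wpM2r// ltW.
have := @bochner_integral_functional _ _ _ _ mu b 0 K M _ _ KM harmonic_b.
rewrite linear0; apply.
  move=> w; apply: (measurable_fun_continuous (fun h => `|b h - w|)) => h.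
  apply: cvg_norm; apply: cvgB; last exact: cvg_cst.
  exact: cocycle_b.1.
apply: (measurable_fun_continuous (fun h => K (b h) : R)) => h.
by apply: (@continuous_comp _ _ _ b K); [exact: cocycle_b.1|exact: cK].
Qed.

Lemma measurable_affine_norm (a c r : R) :
  measurable_fun setT (fun h : borel G => a + c * `|b h| `^ r).
Proof.
apply: measurable_funD => //; apply: measurable_funM => //.
by have := measurable_norm_cocycle r 1%g; under eq_fun do rewrite mul1g.
Qed.

Lemma integral_affine_norm (a c r : R) : 0 <= a -> 0 <= c ->
  (\int[mu]_h (a + c * `|b h| `^ r)%:E =
   a%:E + c%:E * \int[mu]_h (`|b h| `^ r)%:E)%E.
Proof.
move=> a0 c0.
have mb : measurable_fun setT (fun h : borel G => (`|b h| `^ r)%:E).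
  apply/measurable_EFinP.
  by have := measurable_norm_cocycle r 1%g; under eq_fun do rewrite mul1g.
under eq_integral do rewrite EFinD EFinM.
rewrite ge0_integralD//; first last.
- exact: emeasurable_funM.
- by move=> h _; rewrite mule_ge0 ?lee_fin ?powR_ge0.
rewrite integral_cst// [X in (_ * X)%E](_ : _ = 1%E).
  by rewrite mule1 ge0_integralZl_EFin.
exact: (@probability_setT _ _ _ mu).
Qed.

Lemma uniformly_convex_step (p c : R) (g : G) : 1 < p -> 0 < c ->
  smooth_space E -> uniformly_convex E p c ->
  ((`|b g| `^ p)%:E + c%:E * \int[mu]_h (`|b h| `^ p)%:E <=
   \int[mu]_h (`|b (g * h)%g| `^ p)%:E)%E.
Proof.
move=> p1 c0 sE ucE.
have [L [[M LM] Lb]] := uniformly_convex_support p c (b g) p1 sE ucE.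
have [iL L0] := harmonic_functional L M g LM.
rewrite -integral_affine_norm ?powR_ge0 ?(ltW c0)//.
apply: (@le_integral_mean_zero _ (borel G) R mu
  (fun h => `|b g| `^ p + c * `|b h| `^ p)
  (fun h => `|b (g * h)%g| `^ p) (fun h => L (pi g (b h))) _ _ _ _ iL L0).
- by move=> h; rewrite addr_ge0 ?mulr_ge0 ?powR_ge0 ?(ltW c0).
- by move=> h; rewrite powR_ge0.
- exact: measurable_affine_norm.
- exact: measurable_norm_cocycle.
- move=> h; have := Lb (pi g (b h)); rewrite (rep_isometry rep_pi) cocycle_b.2.
  by rewrite addrAC.
Qed.

Lemma uniformly_smooth_step (q d : R) (g : G) : 1 < q -> 0 < d ->
  uniformly_smooth E q d ->
  (\int[mu]_h (`|b (g * h)%g| `^ q)%:E <=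
   (`|b g| `^ q)%:E + d%:E * \int[mu]_h (`|b h| `^ q)%:E)%E.
Proof.
move=> q1 d0 usE.
have [L [[M LM] Lb]] := uniformly_smooth_support q d (b g) q1 d0 usE.
have NLM y : `|- L y| <= M * `|y| by rewrite normrN.
have [iL L0] := harmonic_functional (\- L) M g NLM.
rewrite -integral_affine_norm ?powR_ge0 ?(ltW d0)//.
apply: (@le_integral_mean_zero _ (borel G) R mu
  (fun h => `|b (g * h)%g| `^ q) (fun h => `|b g| `^ q + d * `|b h| `^ q)
  (fun h => - L (pi g (b h))) _ _ _ _ iL L0).
- by move=> h; rewrite powR_ge0.
- by move=> h; rewrite addr_ge0 ?mulr_ge0 ?powR_ge0 ?(ltW d0).
- exact: measurable_norm_cocycle.
- exact: measurable_affine_norm.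
- move=> h; have := Lb (pi g (b h)).
  by rewrite (rep_isometry rep_pi) cocycle_b.2 /=; lra.
Qed.

End harmonic.

(** * Moments of the walk *)

Section growth.
Context {R : realType} {G : topologicalGroupType} {E : normedModType R}.
Variables (mu : probability (borel G) R) (pi : G -> E -> E) (b : G -> E).
Hypotheses (cocycle_b : cocycle pi b).
Hypothesis measurable_ltranslate_mu : forall A : set (borel G),
  measurable A -> measurable_fun setT (ltranslate mu ^~ A).
Variables (r c : R).
Hypotheses (r0 : 0 < r) (c0 : 0 < c).

Let J := (\int[mu]_h (`|b h| `^ r)%:E)%E.

Let I n := (\int[convolution_pow mu n]_x (`|b x| `^ r)%:E)%E.

Let b0 (x : borel G) : (0 <= (`|b x| `^ r)%:E)%E.
Proof. by rewrite lee_fin powR_ge0. Qed.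

Let J0 : (0 <= J)%E.
Proof. by apply: integral_ge0 => h _; exact: b0. Qed.

Let cJ0 : (0 <= c%:E * J)%E.
Proof. by rewrite mule_ge0 ?lee_fin ?(ltW c0). Qed.

Let mb : measurable_fun setT (fun h : borel G => (`|b h| `^ r)%:E).
Proof.
apply/measurable_EFinP.
have := measurable_norm_cocycle pi b cocycle_b r 1%g.
by under eq_fun do rewrite mul1g.
Qed.

Let step (g : borel G) := (\int[mu]_h (`|b (g * h)%g| `^ r)%:E)%E.

Let mstep : measurable_fun setT step.
Proof.
exact: (measurable_integral_ltranslate mu measurable_ltranslate_mu
  (fun x => (`|b x| `^ r)%:E)).
Qed.

Let walk n : exists Q : probability (borel G) R,
  I n = (\int[Q]_x (`|b x| `^ r)%:E)%E /\ I n.+1 = (\int[Q]_g step g)%E.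
Proof.
have [Q [QE _ QS]] := convolution_pow_probability mu measurable_ltranslate_mu.
exists (Q n); split.
  by apply: eq_integral_set_function; exact: QE.
apply: etrans (QS n _ b0 mb).
by apply: eq_integral_set_function; exact: (QE n.+1).
Qed.

Let I0 n : (0 <= I n)%E.
Proof.
by have [Q [-> _]] := walk n; apply: integral_ge0 => x _; exact: b0.
Qed.

Let I1 : I 1 = J.
Proof.
have [Q [QE Q0 QS]] := convolution_pow_probability mu measurable_ltranslate_mu.
rewrite /I (eq_integral_set_function _ _ (Q 1%N)); last exact: QE.
rewrite QS// Q0 ?/J; last exact: mstep.
by under eq_integral do rewrite mul1g.
Qed.

Let integral_shift (Q : probability (borel G) R) :
  (\int[Q]_g ((`|b g| `^ r)%:E + c%:E * J) =
   \int[Q]_g (`|b g| `^ r)%:E + c%:E * J)%E.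
Proof.
rewrite ge0_integralD// integral_cst// [X in (_ + _ * X)%E](_ : _ = 1%E).
  by rewrite mule1.
exact: (@probability_setT _ _ _ Q).
Qed.

Let slope_ge0 k : 0 <= c * (k.+1%:R - 1) + 1.
Proof. by rewrite addr_ge0// mulr_ge0 ?(ltW c0)// -natrB// ler0n. Qed.

Let slopeS k : ((c * (k.+2%:R - 1) + 1)%:E * J =
  (c * (k.+1%:R - 1) + 1)%:E * J + c%:E * J)%E.
Proof.
rewrite -ge0_muleDl ?lee_fin ?slope_ge0 ?(ltW c0)//.
by rewrite -EFinD -[k.+2%:R]natr1; congr (_%:E * _)%E; ring.
Qed.

Let poweR_slope k :
  (((c * (k.+1%:R - 1) + 1) `^ r^-1)%:E * Lr_norm mu r (b : borel G -> E) =
   ((c * (k.+1%:R - 1) + 1)%:E * J) `^ r^-1)%E.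
Proof. by rewrite poweRM ?lee_fin ?slope_ge0. Qed.

Let ler_root (x y : \bar R) : (0 <= x)%E -> (0 <= y)%E -> (x <= y)%E ->
  (x `^ r^-1 <= y `^ r^-1)%E.
Proof.
move=> x0 y0; apply: gt0_ler_poweR; first by rewrite invr_ge0 ltW.
- by rewrite in_itv/= leey andbT.
- by rewrite in_itv/= leey andbT.
Qed.

Lemma Lr_norm_convolution_ge :
  (forall g, (`|b g| `^ r)%:E + c%:E * \int[mu]_h (`|b h| `^ r)%:E <=
     \int[mu]_h (`|b (g * h)%g| `^ r)%:E)%E ->
  forall n, (1 <= n)%N ->
  (((c * (n%:R - 1) + 1) `^ r^-1)%:E * Lr_norm mu r (b : borel G -> E)
    <= Lr_norm (convolution_pow mu n) r (b : borel G -> E))%E.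
Proof.
move=> step_ge [//|n] _; rewrite poweR_slope.
apply: (ler_root _ (I n.+1)) => //.
  by rewrite mule_ge0// lee_fin slope_ge0.
elim: n => [|n IHn]; first by rewrite subrr mulr0 add0r mul1e I1.
rewrite slopeS; apply: (@le_trans _ _ (I n.+1 + c%:E * J)%E).
  by rewrite leeD2r.
have [Q [-> ->]] := walk n.+1; rewrite -integral_shift.
apply: ge0_le_integral.
- exact: measurableT.
- by move=> g _; exact: adde_ge0.
- exact: emeasurable_funD.
- exact: mstep.
- by move=> g _; exact: step_ge.
Qed.

Lemma Lr_norm_convolution_le :
  (forall g, \int[mu]_h (`|b (g * h)%g| `^ r)%:E <=
    (`|b g| `^ r)%:E + c%:E * \int[mu]_h (`|b h| `^ r)%:E)%E ->
  forall n, (1 <= n)%N ->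
  (Lr_norm (convolution_pow mu n) r (b : borel G -> E) <=
    ((c * (n%:R - 1) + 1) `^ r^-1)%:E * Lr_norm mu r (b : borel G -> E))%E.
Proof.
move=> step_le [//|n] _; rewrite poweR_slope.
apply: (ler_root (I n.+1)) => //.
  by rewrite mule_ge0// lee_fin slope_ge0.
elim: n => [|n IHn]; first by rewrite subrr mulr0 add0r mul1e I1.
rewrite slopeS; apply: (@le_trans _ _ (I n.+1 + c%:E * J)%E); last first.
  by rewrite leeD2r.
have [Q [-> ->]] := walk n.+1; rewrite -integral_shift.
apply: ge0_le_integral.
- exact: measurableT.
- by move=> g _; apply: integral_ge0 => h _; exact: b0.
- exact: mstep.
- exact: emeasurable_funD.
- by move=> g _; exact: step_le.
Qed.

End growth.

Theorem theorem3 (R : realType) (G : topologicalGroupType)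
  (m : {measure set (borel G) -> \bar R}) (S : set G)
  (mu : probability (borel G) R)
  (E : completeNormedModType R) (pi : G -> E -> E) (b : G -> E)
  (hausdorffG : hausdorff_space G)
  (locally_compactG : locally_compact [set: G])
  (haar_m : haar_measure m)
  (compactS : compact S) (generatesS : generates S)
  (adapted_mu : cohomologically_adapted m S mu)
  (rep_pi : isometric_representation pi)
  (cocycle_b : cocycle pi b)
  (harmonic_b : mu_harmonic mu b) :
  (forall p c : R, 1 < p -> 0 < c ->
    smooth_space E -> uniformly_convex E p c ->
    forall n : nat, (1 <= n)%N ->
      (((c * (n%:R - 1) + 1) `^ p^-1)%:E * Lr_norm mu p (b : borel G -> E)
       <= Lr_norm (convolution_pow mu n) p (b : borel G -> E))%E) /\
  (forall q d : R, 1 < q -> q <= 2 -> 0 < d ->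
    uniformly_smooth E q d ->
    forall n : nat, (1 <= n)%N ->
      (Lr_norm (convolution_pow mu n) q (b : borel G -> E)
       <= ((d * (n%:R - 1) + 1) `^ q^-1)%:E * Lr_norm mu q (b : borel G -> E))%E).
Proof.
have mtrans :=
  measurable_ltranslate_adapted _ _ _ _ _ hausdorffG haar_m adapted_mu.
split=> [p c p1 c0 smoothE convexE|q d q1 _ d0 smoothE].
  apply: (Lr_norm_convolution_ge _ _ _ cocycle_b mtrans) => // [|g].
    exact: lt_trans p1.
  exact: (uniformly_convex_step _ _ _ rep_pi cocycle_b harmonic_b).
apply: (Lr_norm_convolution_le _ _ _ cocycle_b mtrans) => // [|g].
  exact: lt_trans q1.
exact: (uniformly_smooth_step _ _ _ rep_pi cocycle_b harmonic_b).
Qed.
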